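(* Let $(\Omega,\mathcal{F},\mathbb{P})$ be a probability space, $t\ge1$ an integer, and $Z$ a random variable on it with $0\le Z\le1$. For $0\le i<t$ let $U_i:(\Omega,\mathcal{F})\to(\Omega_i',\mathcal{F}_i')$ be random objects (not necessarily identically distributed), let $W_i=\mathbb{E}(Z\mid U_i)$ (a random variable on $(\Omega'_i,\mathcal{F}'_i,\mathbb{P}_{U_i})$), let $0<\varepsilon_i<1$, and let $\varepsilon=\big(\sum_{i<t}\varepsilon_i\big)/t$. (i) If the random objects $U_i$ are independent, then $$\mathbb{E}(Z)\le\prod_{i<t}\mathbb{P}_{U_i}\{W_i>\varepsilon_i\}+t\varepsilon .$$ (ii) If $0\le\beta\le1$ and the random objects $U_i$ are $\beta$-independent, then $$\mathbb{E}(Z)\le\prod_{i<t}\big(\alpha+\beta\,\mathbb{P}_{U_i}\{W_i>\varepsilon_i\}\big)+t\varepsilon ,$$ where $\alpha=1-\beta$.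
   Context: A random object on $(\Omega,\mathcal{F},\mathbb{P})$ is a measurable function $U:(\Omega,\mathcal{F})\to(\Omega',\mathcal{F}')$; it induces the probability measure $\mathbb{P}_U(T)=\mathbb{P}\{U\in T\}$ on $(\Omega',\mathcal{F}')$. Conditional expectation (Kolmogorov's convention): for a random variable $Z$ on $\Omega$ and a random object $U:\Omega\to\Omega'$, $\mathbb{E}(Z\mid U)$ is a random variable $V$ on $(\Omega',\mathcal{F}',\mathbb{P}_U)$ (not on $\Omega$) such that $\int_S V\,d\mathbb{P}_U=\int_{\{U\in S\}}Z\,d\mathbb{P}$ for all $S\in\mathcal{F}'$; it is unique up to a $\mathbb{P}_U$-null set. $\beta$-independence: for $0\le\beta\le1$ and $\alpha=1-\beta$, random objects $U_i:(\Omega,\mathcal{F})\to(\Omega'_i,\mathcal{F}'_i)$, $i<t$, are $\beta$-independent if for all events $T_i\in\mathcal{F}'_i$, writing $\mu_i=\mathbb{P}_{U_i}(T_i)$, $$\mathbb{P}\Big\{\bigwedge_{0\le i<t}U_i\in T_i\Big\}\le\prod_{0\le i<t}(\alpha+\beta\mu_i).$$ *)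

(* Defs.v *)
From HB Require Import structures.
From mathcomp Require Import all_boot all_order all_algebra.
From mathcomp Require Import all_classical all_reals all_analysis.

Set Implicit Arguments.
Unset Strict Implicit.
Unset Printing Implicit Defensive.

Import Order.TTheory GRing.Theory Num.Theory.
Import numFieldNormedType.Exports.

Local Open Scope classical_set_scope.
Local Open Scope ring_scope.

(* Kolmogorov's convention: V lives on the codomain of U and is a version of
   E(Z | U).  If Z is integrable then so is V, by taking for S the sets
   {V >= 0} and {V < 0}, so integrability of V need not be required. *)
Definition is_cond_expectation (d d' : measure_display) (T : measurableType d)
    (T' : measurableType d') (R : realType) (P : probability T R)
    (Z : {RV P >-> R}) (U : {RV P >-> T'})
    (V : {RV distribution P U >-> R}) : Prop :=
  forall S : set T', measurable S ->
    (\int[distribution P U]_(y in S) (V y)%:E =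
     \int[P]_(x in U @^-1` S) (Z x)%:E)%E.
Arguments is_cond_expectation {d d' T T' R P} Z U V.

(* The product rule for subfamilies is the case where some S i are setT. *)
Definition independent_RVs (d : measure_display) (T : measurableType d)
    (R : realType) (P : probability T R) (t : nat)
    (d' : 'I_t -> measure_display) (T' : forall i, measurableType (d' i))
    (U : forall i, {RV P >-> T' i}) : Prop :=
  forall S : forall i, set (T' i), (forall i, measurable (S i)) ->
    P (\bigcap_i (U i @^-1` S i)) =
    (\prod_(i < t) distribution P (U i) (S i))%E.

Definition beta_independent_RVs (d : measure_display) (T : measurableType d)
    (R : realType) (P : probability T R) (beta : R) (t : nat)
    (d' : 'I_t -> measure_display) (T' : forall i, measurableType (d' i))
    (U : forall i, {RV P >-> T' i}) : Prop :=
  let alpha : R := 1 - beta in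
  forall S : forall i, set (T' i), (forall i, measurable (S i)) ->
    (P (\bigcap_i (U i @^-1` S i)) <=
     \prod_(i < t) (alpha%:E + beta%:E * distribution P (U i) (S i)))%E.

(* Main.v *)
(** Let [B] be the event that [W i (U i) > eps i] for every [i]. The integral of [Z]
    over [B] is at most [P B], which (beta-)independence bounds by the product.
    Off [B] some [W i (U i) <= eps i]; by definition of the conditional expectation
    the integral of [Z] over that event equals the integral of [W i] over
    [{W i <= eps i}], which is at most [eps i]. *)

Require Import Defs.
From HB Require Import structures.
From mathcomp Require Import all_boot all_order all_algebra.
From mathcomp Require Import all_classical all_reals all_analysis.
From mathcomp Require Import measurable_realfun.

Import Order.TTheory GRing.Theory Num.Theory.
Import numFieldNormedType.Exports.

Local Open Scope classical_set_scope.
Local Open Scope ring_scope.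

(* Only the positive part of [f] matters, so [f] need not be integrable. *)
Lemma integral_le_cst {d} {T : measurableType d} {R : realType}
    (mu : {measure set T -> \bar R}) (D : set T) (f : T -> \bar R) (c : R) :
  measurable D -> measurable_fun D f -> 0 <= c ->
  (forall x, D x -> (f x <= c%:E)%E) ->
  (\int[mu]_(x in D) f x <= c%:E * mu D)%E.
Proof.
move=> mD mf c0 fc; rewrite integralE.
apply: (@le_trans _ _ (\int[mu]_(x in D) (f^\+)%E x)%E).
  by rewrite geeDl// oppe_le0 integral_ge0.
rewrite -integral_cst//; apply: ge0_le_integral => //.
- exact: measurable_funepos.
- by move=> x Dx; rewrite funeposE ge_max fc//= lee_fin.
Qed.

Lemma ge0_integral_le_bigcap_setC {d} {T : measurableType d} {R : realType}
    (mu : {measure set T -> \bar R}) (n : nat) (D : 'I_n -> set T)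
    (f : T -> \bar R) :
  (forall i, measurable (D i)) -> measurable_fun setT f ->
  (forall x, (0 <= f x <= 1)%E) ->
  (\int[mu]_x f x <=
   mu (\bigcap_i D i) + \sum_(i < n) \int[mu]_(x in ~` D i) f x)%E.
Proof.
move=> mD mf f01.
have f0 x : (0 <= f x)%E by case/andP: (f01 x).
have mB : measurable (\bigcap_i D i) by exact: fin_bigcap_measurable.
have mDC i : measurable (~` D i) by exact: measurableC.
have mfr i : measurable_fun setT (f \_ (~` D i)).
  by apply: (measurable_restrictT f (mDC i)).1; exact: measurable_funTS.
have fr0 i x : (0 <= (f \_ (~` D i)) x)%E by rewrite patchE; case: ifP.
have m1 : measurable_fun setT (fun x => (\1_(\bigcap_i D i) x : R)%:E).
  by apply/measurable_EFinP; exact: measurable_indic.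
rewrite -[in leRHS](setIT (\bigcap_i D i)) -integral_indic//.
under [in leRHS]eq_bigr do rewrite integral_mkcond.
rewrite -ge0_integral_sum// -ge0_integralD//; last 2 first.
- by move=> x _; exact: sume_ge0.
- exact: emeasurable_sum.
apply: ge0_le_integral => //.
  by apply: emeasurable_funD; [exact: m1|exact: emeasurable_sum].
move=> x _ /=; have [xB|/existsNP[i /not_implyP[_ xD]]] :=
    pselect ((\bigcap_i D i) x).
  rewrite indicE mem_set//=; apply: (@le_trans _ _ 1%E).
    by case/andP: (f01 x).
  by rewrite leeDl// sume_ge0.
(* The summand of the failing index [i] equals [f x]; the indicator and the other summands are
   nonnegative. *)
rewrite (bigD1 i)//= patchE mem_set// addeCA leeDl//.
by rewrite adde_ge0// ?lee_fin// sume_ge0.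
Qed.

(** The part common to (i) and (ii): it remains only to bound the probability of the
    intersection. *)
Lemma expectation_le_bigcap_cond_expectation {d} {Omega : measurableType d}
    {R : realType} (P : probability Omega R) (t : nat)
    (Z : {RV P >-> R}) (d' : 'I_t -> measure_display)
    (Omega' : forall i, measurableType (d' i))
    (U : forall i, {RV P >-> Omega' i})
    (W : forall i, {RV distribution P (U i) >-> R}) (eps : 'I_t -> R) :
  (forall x, 0 <= Z x <= 1) ->
  (forall i, is_cond_expectation Z (U i) (W i)) ->
  (forall i, 0 <= eps i) ->
  ('E_P[Z] <= P (\bigcap_i (U i @^-1` [set y | (eps i < W i y)%R]))
              + (\sum_(i < t) eps i)%:E)%E.
Proof.
move=> Z01 WE eps0; rewrite unlock.
have mS i : measurable [set y | (eps i < W i y)%R].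
  rewrite -[X in measurable X]setTI.
  by apply: measurable_fun_ltr => //; exact: measurable_funPT.
apply: le_trans (ge0_integral_le_bigcap_setC P t
  (fun i => U i @^-1` [set y | (eps i < W i y)%R]) (EFin \o Z) _ _ _) _.
- by move=> i; rewrite -[X in measurable X]setTI; exact: measurable_funPT.
- by apply/measurable_EFinP; exact: measurable_funPT.
- by move=> x; rewrite /= !lee_fin.
rewrite leeD2l// -sumEFin; apply: lee_sum => i _.
(* The complement of a preimage is the preimage of [{W i <= eps i}], a set to which the defining
   identity of [W i] applies. *)
rewrite preimage_setC -WE; last exact: measurableC.
apply: le_trans (integral_le_cst _ _ _ (eps i) _ _ _ _) _ => //.
- exact: measurableC.
- by apply: measurable_funTS; apply/measurable_EFinP; exact: measurable_funPT.
- by move=> y /= /negP; rewrite -leNgt lee_fin.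
(* The probability of [{W i <= eps i}] is bounded by 1, so each index costs [eps i]. *)
- rewrite -[leRHS]mule1; apply: lee_wpmul2l; first by rewrite lee_fin.
  by apply: probability_le1; exact: measurableC.
Qed.

Theorem theorem2p2 (d : measure_display) (Omega : measurableType d)
    (R : realType) (P : probability Omega R) (t : nat) (t_ge1 : (1 <= t)%N)
    (Z : {RV P >-> R}) (Z01 : forall x : Omega, 0 <= Z x <= 1)
    (d' : 'I_t -> measure_display)
    (Omega' : forall i : 'I_t, measurableType (d' i))
    (U : forall i : 'I_t, {RV P >-> Omega' i})
    (W : forall i : 'I_t, {RV distribution P (U i) >-> R})
    (WE : forall i : 'I_t, is_cond_expectation Z (U i) (W i))
    (eps : 'I_t -> R) (eps01 : forall i : 'I_t, 0 < eps i < 1) :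
  let epsbar : R := (\sum_(i < t) eps i) / t%:R in
  (independent_RVs U ->
    ('E_P[Z] <=
     \prod_(i < t) distribution P (U i) [set y | (eps i < W i y)%R]
     + (t%:R * epsbar)%:E)%E)
  /\
  (forall beta : R, 0 <= beta <= 1 -> beta_independent_RVs beta U ->
    let alpha : R := 1 - beta in
    ('E_P[Z] <=
     \prod_(i < t) (alpha%:E
        + beta%:E * distribution P (U i) [set y | (eps i < W i y)%R])
     + (t%:R * epsbar)%:E)%E).
Proof.
move=> epsbar.
have mS i : measurable [set y | (eps i < W i y)%R].
  rewrite -[X in measurable X]setTI.
  by apply: measurable_fun_ltr => //; exact: measurable_funPT.
have -> : t%:R * epsbar = \sum_(i < t) eps i.
  by rewrite mulrC divfK// pnatr_eq0 -lt0n.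
have eps0 i : 0 <= eps i by case/andP: (eps01 i) => /ltW.
have EZ := expectation_le_bigcap_cond_expectation P t Z d' Omega' U W eps Z01 WE eps0.
(* Each independence hypothesis is used once, with the sets [{eps i < W i}]: as an equality in (i),
   as an inequality in (ii). *)
split=> [indU|beta _ indU] /=; apply: (le_trans EZ); rewrite leeD2r//.
- by rewrite indU.
- exact: indU.
Qed.
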